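(* Let $w_1,w_2\in(0,1)$, let $f,g\colon[0,1]\to[-\infty,\infty]$ be strictly monotone continuous functions such that $\min\{|f(0)|,|g(0)|\}<\infty$ and $\min\{|f(1)|,|g(1)|\}<\infty$, and let $\mathrm{K}_{w_1}^{f}$ and $\mathrm{K}_{w_2}^{g}$ be the quasi-linear means generated by $f$ and $g$. Set $\widehat f=f|_{(0,1)}$, $\widehat g=g|_{(0,1)}$ and $\widehat h=\widehat g\circ\widehat f^{-1}\colon \operatorname{Ran}(\widehat f)\to\mathbb R$. Then: (a) If $w_1=w_2$, then the pair $(\mathrm{K}_{w_1}^{f},\mathrm{K}_{w_2}^{g})$ is admissible if and only if $\widehat h$ is strictly convex or strictly concave. Moreover, if $w_1\neq w_2$, then $(\mathrm{K}_{w_1}^{f},\mathrm{K}_{w_2}^{g})$ is admissible whenever one of the following conditions is satisfied: (b) $\widehat f$ is strictly increasing and either (b1) $w_1<w_2$ and one of the functions $\widehat h$, $-\widehat h$ is both convex and strictly increasing, or (b2) $w_1>w_2$ and one of the functions $\widehat h$, $-\widehat h$ is both convex and strictly decreasing; (c) $\widehat f$ is strictly decreasing and either (c1) $w_1<w_2$ and one of the functions $\widehat h$, $-\widehat h$ is both convex and strictly decreasing, or (c2) $w_1>w_2$ and one of the functions $\widehat h$, $-\widehat h$ is both convex and strictly increasing.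
   Context: Let $\mathsf{Int}_{[0,1]}=\{[a_1,a_2]: 0\le a_1\le a_2\le 1\}$ (degenerate intervals allowed); write $\mathbf u=[u_1,u_2]$. The interval order is: $\mathbf u\preceq_{\mathrm{Int}}\mathbf x$ iff $u_1\le x_1$ and $u_2\le x_2$. An admissible order is a total order $\preceq$ on $\mathsf{Int}_{[0,1]}$ such that $\mathbf u\preceq_{\mathrm{Int}}\mathbf x$ implies $\mathbf u\preceq\mathbf x$. An aggregation function (AF) is a function $\mathrm A\colon\mathsf{Int}_{[0,1]}\to[0,1]$ with $\mathrm A([0,0])=0$, $\mathrm A([1,1])=1$, and $\mathrm A(\mathbf u)\le\mathrm A(\mathbf x)$ whenever $u_1\le x_1$ and $u_2\le x_2$. For a pair $(\mathrm A,\mathrm B)$ of AFs, the relation $\preceq_{\mathrm A,\mathrm B}$ is defined by: $\mathbf u\preceq_{\mathrm A,\mathrm B}\mathbf x$ iff $\mathrm A(\mathbf u)<\mathrm A(\mathbf x)$, or $\mathrm A(\mathbf u)=\mathrm A(\mathbf x)$ and $\mathrm B(\mathbf u)\le\mathrm B(\mathbf x)$. The pair $(\mathrm A,\mathrm B)$ is admissible if $\preceq_{\mathrm A,\mathrm B}$ is an admissible order. For $w\in(0,1)$ and a strictly monotone continuous $f\colon[0,1]\to[-\infty,\infty]$, the quasi-linear mean generated by $f$ is $\mathrm K_w^f\colon\mathsf{Int}_{[0,1]}\to[0,1]$, $\mathrm K_w^f([z_1,z_2])=f^{-1}\big((1-w)f(z_1)+wf(z_2)\big)$, with the convention $-\infty+\infty=\infty-\infty=-\infty$,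 where $f^{-1}$ is the inverse of $f$ on its range $\operatorname{Ran}(f)$. *)

(* Defs.v *)
From HB Require Import structures.
From mathcomp Require Import all_boot all_order all_algebra.
From mathcomp Require Import all_classical all_reals all_analysis.

Set Implicit Arguments.
Unset Strict Implicit.
Unset Printing Implicit Defensive.

Import Order.TTheory GRing.Theory Num.Theory.
Import numFieldNormedType.Exports.

Local Open Scope classical_set_scope.
Local Open Scope ring_scope.

Section StrictMonotonicity.
Context d d' (T : porderType d) (T' : porderType d').

Definition strictly_increasing (D : set T) (h : T -> T') : Prop :=
  {in D &, forall x y, (x < y)%O -> (h x < h y)%O}.

Definition strictly_decreasing (D : set T) (h : T -> T') : Prop :=
  {in D &, forall x y, (x < y)%O -> (h y < h x)%O}.

Definition strictly_monotone (D : set T) (h : T -> T') : Prop :=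
  strictly_increasing D h \/ strictly_decreasing D h.

End StrictMonotonicity.

Section Intervals.
Context {R : realType}.

Definition Int01 := {u : R * R | [&& 0 <= u.1, u.1 <= u.2 & u.2 <= 1]}.

Definition lo (u : Int01) : R := (val u).1.
Definition hi (u : Int01) : R := (val u).2.

Lemma diag_subproof (a : R) : 0 <= a <= 1 ->
  let u := (a, a) in [&& 0 <= u.1, u.1 <= u.2 & u.2 <= 1].
Proof. by move=> /andP[a0 a1] /=; rewrite a0 a1 lexx. Qed.

Lemma ge0_le1_0 : 0 <= (0 : R) <= 1. Proof. by rewrite lexx ler01. Qed.
Lemma ge0_le1_1 : 0 <= (1 : R) <= 1. Proof. by rewrite lexx ler01. Qed.

Definition int00 : Int01 := exist _ (0, 0) (diag_subproof ge0_le1_0).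
Definition int11 : Int01 := exist _ (1, 1) (diag_subproof ge0_le1_1).

Definition le_Int : rel Int01 := fun u x => (lo u <= lo x) && (hi u <= hi x).

Definition admissible_order (r : rel Int01) : Prop :=
  [/\ reflexive r, antisymmetric r, transitive r, total r
    & forall u x, le_Int u x -> r u x].

Definition aggregation_function (A : Int01 -> R) : Prop :=
  [/\ forall u, 0 <= A u <= 1,
      A int00 = 0,
      A int11 = 1
    & forall u x, le_Int u x -> A u <= A x].

Definition le_pair (A B : Int01 -> R) : rel Int01 :=
  fun u x => (A u < A x) || ((A u == A x) && (B u <= B x)).

Definition admissible_pair (A B : Int01 -> R) : Prop :=
  [/\ aggregation_function A, aggregation_function B
    & admissible_order (le_pair A B)].

(* On [\bar R], [+oo + -oo = -oo + +oo = -oo]. Only the values of [f] on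
   [[0, 1]] matter; [pinv] is the inverse of [f] on the image of [[0, 1]]. *)
Definition quasi_linear_mean (w : R) (f : R -> \bar R) : Int01 -> R :=
  fun z => pinv (`[0, 1] : set R) f ((1 - w)%:E * f (lo z) + w%:E * f (hi z))%E.

(* A strictly monotone [f] on [[0, 1]] is finite on the open interval, so that
   [fine] only changes the codomain there. *)
Definition fhat (f : R -> \bar R) : R -> R := fine \o f.

Definition ran_hat (f : R -> \bar R) : set R := fhat f @` `]0, 1[.

(* Meaningful on [ran_hat f] only. *)
Definition hhat (f g : R -> \bar R) : R -> R :=
  fhat g \o pinv (`]0, 1[ : set R) (fhat f).

Local Open Scope convex_scope.

Definition strictly_convex (D : set R) (h : R -> R) : Prop :=
  forall t : {i01 R}, 0 < t%:num < 1 ->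
    {in D &, forall x y : R^o, x != y ->
      (h (x <| t |> y) : R) < (h x : R^o) <| t |> (h y : R^o)}.

Definition strictly_concave (D : set R) (h : R -> R) : Prop :=
  strictly_convex D (\- h).

End Intervals.
Arguments Int01 R : clear implicits.

(* Main.v *)
(** For two intervals that are not nested, strict monotonicity of one of the two
    generators separates their means (the hypotheses at [0] and [1] ensure that
    this generator is finite at the common endpoint, if any). So the pair is
    admissible iff no strictly nested [a < c <= d < b] satisfy both
    [(1 - w1) (F c - F a) = w1 (F b - F d)] and
    [(1 - w2) (G c - G a) = w2 (G b - G d)], where [F] and [G] are the finite
    parts of [f] and [g]. If [G \o F^-1] is convex, the first equation turns the
    second one into an inequality, strict under strict convexity, and also strict
    when the weights differ in the direction that matches the monotonicity of
    [G]. Conversely, taking [c = d] shows that [G \o F^-1] never sends a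
    [w]-weighted mean to the [w]-weighted mean; by connectedness the sign of the
    defect is constant, and a continuous function that is strictly convex for a
    single weight is strictly convex. *)
Require Import Defs.
From mathcomp Require Import all_boot all_order all_algebra.
From mathcomp Require Import all_classical all_reals all_analysis.
From mathcomp Require Import ring lra.

Set Implicit Arguments.
Unset Strict Implicit.
Unset Printing Implicit Defensive.

Import Order.TTheory GRing.Theory Num.Theory.
Import numFieldNormedType.Exports.

Local Open Scope classical_set_scope.
Local Open Scope ring_scope.

(** * Triangle areas on the curve [(F, G)] and nested weighted means *)

Section Area.
Context {R : realType}.
Implicit Types (F G : R -> R) (a b c d w x y z : R).

(* Twice the signed area of the triangle with vertices [(F t, G t)],
   [t = x, y, z]; for increasing [F] it is nonnegative iff [G \o F^-1] lies
   below its chord at [F y]. *)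
Definition area F G x y z : R :=
  (F y - F x) * (G z - G x) - (F z - F x) * (G y - G x).

(** Convexity is known on the open interval only. A vertex at an endpoint is reached as a one-sided
    limit, which preserves weak inequalities. *)
Lemma area_ge0_at_right F G a y z : a < y ->
  (forall x, a < x -> x < y -> 0 <= area F G x y z) ->
  F x @[x --> a^'+] --> F a -> G x @[x --> a^'+] --> G a ->
  0 <= area F G a y z.
Proof.
move=> ay FG Fa Ga.
have cv : area F G x y z @[x --> a^'+] --> area F G a y z.
  by apply: cvgB; apply: cvgM; apply: cvgB => //; exact: cvg_cst.
rewrite -(cvg_lim _ cv)//; apply: limr_ge; first by apply/cvg_ex; eexists; exact: cv.
near=> x; apply: FG; near: x; [exact: nbhs_right_gt|exact: nbhs_right_lt].
Unshelve. all: by end_near. Qed.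

Lemma area_ge0_at_left F G x y b : y < b ->
  (forall z, y < z -> z < b -> 0 <= area F G x y z) ->
  F x @[x --> b^'-] --> F b -> G x @[x --> b^'-] --> G b ->
  0 <= area F G x y b.
Proof.
move=> yb FG Fb Gb.
have cv : area F G x y z @[z --> b^'-] --> area F G x y b.
  apply: cvgB; apply: cvgM; first exact: cvg_cst.
  - by apply: cvgB => //; exact: cvg_cst.
  - by apply: cvgB => //; exact: cvg_cst.
  - exact: cvg_cst.
rewrite -(cvg_lim _ cv)//; apply: limr_ge; first by apply/cvg_ex; eexists; exact: cv.
near=> z; apply: FG; near: z; [exact: nbhs_left_gt|exact: nbhs_left_lt].
Unshelve. all: by end_near. Qed.

(** Limits lose strictness; this identity restores it. For a vertex [x] at the endpoint it combines
    a triangle away from [x], whose area is strictly positive, with one at [x], whose area is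
    nonnegative by a limit. *)
Lemma area_splitl F G x y' y z :
  area F G x y z * (F y - F y') =
  (F y - F x) * area F G y' y z + (F z - F y) * area F G x y' y.
Proof. by rewrite /area; ring. Qed.

Lemma area_splitr F G x y y' z :
  area F G x y z * (F y' - F y) =
  (F z - F y) * area F G x y y' + (F y - F x) * area F G y y' z.
Proof. by rewrite /area; ring. Qed.

Section Closed.
Variables (F G : R -> R) (a b : R).
Hypotheses (a0 : 0 <= a) (b1 : b <= 1).
Hypotheses (Fa : F x @[x --> a^'+] --> F a) (Ga : G x @[x --> a^'+] --> G a).
Hypotheses (Fb : F x @[x --> b^'-] --> F b) (Gb : G x @[x --> b^'-] --> G b).

Lemma area_ge0_closed y :
  (forall x y z, 0 < x -> x < y -> y < z -> z < 1 -> 0 <= area F G x y z) ->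
  a < y -> y < b -> 0 <= area F G a y b.
Proof.
move=> FG ay yb; apply: area_ge0_at_right => // x ax xy.
apply: area_ge0_at_left => // z yz zb.
by apply: FG => //; [exact: le_lt_trans ax|exact: lt_le_trans b1].
Qed.

Lemma area_gt0_closed y :
  (forall x y z, 0 < x -> x < y -> y < z -> z < 1 -> 0 < area F G x y z) ->
  (forall x y, a <= x -> x < y -> y <= b -> F x < F y) ->
  a < y -> y < b -> 0 < area F G a y b.
Proof.
move=> FG Fi ay yb.
(* The endpoint [a] is treated first, with [z] kept inside; the endpoint [b] is then reached by
   splitting on the right. *)
have left_gt0 u z : a < u -> u < z -> z < b -> 0 < area F G a u z.
  move=> au uz zb; pose v := (a + u) / 2.
  have [av vu] : a < v /\ v < u by rewrite /v; split; lra.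
  have z1 : z < 1 by exact: lt_le_trans b1.
  have v0 : 0 < v by exact: le_lt_trans av.
  have FuFv : 0 < F u - F v by rewrite subr_gt0; apply: Fi => //; lra.
  rewrite -(pmulr_lgt0 _ FuFv) area_splitl; apply: ltr_pwDl.
    by apply: mulr_gt0; [rewrite subr_gt0; apply: Fi => //; lra|exact: FG].
  apply: mulr_ge0; first by rewrite subr_ge0 ltW//; apply: Fi => //; lra.
  apply: area_ge0_at_right => // x ax xv; apply/ltW/FG => //.
    exact: le_lt_trans ax.
  exact: lt_trans uz z1.
pose v := (y + b) / 2.
have [yv vb] : y < v /\ v < b by rewrite /v; split; lra.
have FvFy : 0 < F v - F y by rewrite subr_gt0; apply: Fi => //; lra.
rewrite -(pmulr_lgt0 _ FvFy) area_splitr; apply: ltr_pwDl.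
  by apply: mulr_gt0; [rewrite subr_gt0; apply: Fi => //; lra|exact: left_gt0].
apply: mulr_ge0; first by rewrite subr_ge0 ltW//; apply: Fi => //; lra.
apply: area_ge0_at_left => // z vz zb; apply/ltW/FG => //.
  exact: le_lt_trans ay.
exact: lt_le_trans b1.
Qed.
End Closed.

(** The hypothesis says that the pairs [(a, b)] and [(c, d)] have the same [w]-weighted mean of [F].
    The contributions of the chord through [a] and [b] therefore cancel, leaving only the weighted
    gaps between chord and curve at [c] and [d]. *)
Lemma nested_mean F G w a c d b :
  (1 - w) * (F c - F a) = w * (F b - F d) ->
  (F b - F a) * (w * (G b - G d) - (1 - w) * (G c - G a)) =
  (1 - w) * area F G a c b + w * area F G a d b.
Proof.
move=> e.
have -> : (1 - w) * area F G a c b + w * area F G a d b =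
  ((1 - w) * (F c - F a) + w * (F d - F a)) * (G b - G a) - (F b - F a) *
  ((1 - w) * (G c - G a) + w * (G d - G a)) by rewrite /area; ring.
rewrite e; ring.
Qed.

Section NestedMeans.
Variables (F G : R -> R) (w a c d b : R).
Hypotheses (Fa : F x @[x --> a^'+] --> F a) (Ga : G x @[x --> a^'+] --> G a).
Hypotheses (Fb : F x @[x --> b^'-] --> F b) (Gb : G x @[x --> b^'-] --> G b).
Hypothesis F_incr : forall x y, a <= x -> x < y -> y <= b -> F x < F y.

Lemma nested_mean_le : 0 < w < 1 ->
  0 <= a -> a < c -> c <= d -> d < b -> b <= 1 ->
  (1 - w) * (F c - F a) = w * (F b - F d) ->
  (forall x y z, 0 < x -> x < y -> y < z -> z < 1 -> 0 <= area F G x y z) ->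
  (1 - w) * (G c - G a) <= w * (G b - G d).
Proof.
move=> /andP[w0 w1] a0 ac cd db b1 /nested_mean e FG.
have Fab : 0 < F b - F a by rewrite subr_gt0; apply: F_incr => //; lra.
rewrite -subr_ge0 -(pmulr_rge0 _ Fab) e.
have [ad cb] : a < d /\ c < b by lra.
have w'0 : 0 < 1 - w by rewrite subr_gt0.
by apply: addr_ge0; apply: mulr_ge0; by [exact: ltW|exact: area_ge0_closed].
Qed.

Lemma nested_mean_lt : 0 < w < 1 ->
  0 <= a -> a < c -> c <= d -> d < b -> b <= 1 ->
  (1 - w) * (F c - F a) = w * (F b - F d) ->
  (forall x y z, 0 < x -> x < y -> y < z -> z < 1 -> 0 < area F G x y z) ->
  (1 - w) * (G c - G a) < w * (G b - G d).
Proof.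
move=> /andP[w0 w1] a0 ac cd db b1 /nested_mean e FG.
have Fab : 0 < F b - F a by rewrite subr_gt0; apply: F_incr => //; lra.
rewrite -subr_gt0 -(pmulr_rgt0 _ Fab) e.
have [ad cb] : a < d /\ c < b by lra.
have w'0 : 0 < 1 - w by rewrite subr_gt0.
by apply: addr_gt0; apply: mulr_gt0; by [|exact: area_gt0_closed].
Qed.

End NestedMeans.


(** The weight [(r - q) / (r - p)] is the same for both orders, so increasing and decreasing
    generators are treated together. *)
Lemma between_conv (p q r : R) : (p < q < r) || (r < q < p) ->
  exists t : {i01 R}, [/\ 0 < t%:num < 1, q = t%:num * p + (1 - t%:num) * r
    & t%:num * (r - p) = r - q].
Proof.
move=> pqr.
have rp : r - p != 0 by rewrite subr_eq0; lra.
have t01 : 0 < (r - q) / (r - p) < 1.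
  case/orP: pqr => /andP[pq qr].
    by rewrite divr_gt0 ?ltr_pdivrMr; lra.
  rewrite -mulrNN -invrN divr_gt0 ?ltr_pdivrMr; lra.
have t01' : 0 <= (r - q) / (r - p) <= 1 by lra.
exists (Itv01 (andP t01').1 (andP t01').2); split => //=; by field.
Qed.

End Area.

(** * Strict convexity from a single weight *)

Section MeanConvex.
Context {R : realType}.
Variables (D : set R) (h : R -> R) (v : R).
Hypotheses (itvD : is_interval D) (cont_h : forall x, D x -> {for x, continuous h}).

Let mean x y := (1 - v) * x + v * y.

Let D_mean x y : 0 < v < 1 -> D x -> D y -> x <= y -> D (mean x y).
Proof. by move=> v01 Dx Dy xy; apply: (itvD Dx Dy); rewrite /mean; nra. Qed.

(** The pairs [x < y] in [D] form a convex set. If the defect took both signs, it would vanish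
    somewhere on the segment joining two such pairs, by the intermediate value theorem. *)
Lemma mean_defect_sign : 0 < v < 1 ->
  (forall x y, D x -> D y -> x < y -> h (mean x y) != mean (h x) (h y)) ->
  (forall x y, D x -> D y -> x < y -> h (mean x y) < mean (h x) (h y)) \/
  (forall x y, D x -> D y -> x < y -> mean (h x) (h y) < h (mean x y)).
Proof.
move=> v01 hne; apply: contrapT => /not_orP[/existsNP[x0 /existsNP[y0]]].
move=> /not_implyP[Dx0 /not_implyP[Dy0 /not_implyP[xy0 n0]]].
move=> /existsNP[x1 /existsNP[y1]].
move=> /not_implyP[Dx1 /not_implyP[Dy1 /not_implyP[xy1 n1]]].
pose X t := (1 - t) * x0 + t * x1; pose Y t := (1 - t) * y0 + t * y1.
have XY t : 0 <= t <= 1 -> X t < Y t.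
  move=> /andP[t0 t1]; rewrite /X /Y -subr_gt0.
  have -> : (1 - t) * y0 + t * y1 - ((1 - t) * x0 + t * x1) =
    (1 - t) * (y0 - x0) + t * (y1 - x1) by ring.
  have [->|t_neq1] := eqVneq t 1; first by lra.
  apply: ltr_pwDl; first by rewrite mulr_gt0 ?subr_gt0 // lt_neqAle t_neq1.
  by rewrite mulr_ge0 // subr_ge0 ltW.
have DX t : 0 <= t <= 1 -> D (X t).
  rewrite /X => t01; have [x01|x10] := leP x0 x1.
    by apply: (itvD Dx0 Dx1); nra.
  by apply: (itvD Dx1 Dx0); nra.
have DY t : 0 <= t <= 1 -> D (Y t).
  rewrite /Y => t01; have [x01|x10] := leP y0 y1.
    by apply: (itvD Dy0 Dy1); nra.
  by apply: (itvD Dy1 Dy0); nra.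
have cX : continuous X.
  by move=> t; apply: cvgD; apply: cvgM; try exact: cvg_cst; try exact: cvg_id;
    apply: cvgB; [exact: cvg_cst|exact: cvg_id].
have cY : continuous Y.
  by move=> t; apply: cvgD; apply: cvgM; try exact: cvg_cst; try exact: cvg_id;
    apply: cvgB; [exact: cvg_cst|exact: cvg_id].
have cXY : continuous (fun t => mean (X t) (Y t)).
  by move=> t; apply: cvgD; (apply: cvgM; first exact: cvg_cst); [exact: cX|exact: cY].
pose k t := mean (h (X t)) (h (Y t)) - h (mean (X t) (Y t)).
have ck : {within `[0, 1], continuous k}.
  apply: continuous_in_subspaceT => t; rewrite inE/= in_itv/= => t01.
  apply: cvgB.
    apply: cvgD; (apply: cvgM; first exact: cvg_cst).
      by apply: (continuous_comp (cX t)); exact: cont_h (DX _ t01).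
    by apply: (continuous_comp (cY t)); exact: cont_h (DY _ t01).
  apply: (continuous_comp (cXY t)); apply: cont_h; apply: D_mean; [by []|exact: DX|exact: DY|].
  exact/ltW/XY.
have [k0 k1] : k 0 <= 0 /\ 0 <= k 1.
  rewrite /k /X /Y !subr0 !subrr !mul1r !mul0r !addr0 !add0r.
  by rewrite subr_le0 subr_ge0; split; rewrite leNgt; exact/negP.
have [|t] := IVT (v := 0) ler01 ck; first by rewrite ge_min k0 le_max k1 orbT.
rewrite in_itv/= => t01 /eqP; rewrite subr_eq0 eq_sym; apply/negP.
by apply: hne; [exact: DX|exact: DY|exact: XY].
Qed.

(* A maximizer of [h] minus its chord cannot be interior, since it would be the
   [v]-weighted mean of two points where [h] minus its chord is not larger. *)
Lemma mean_lt_strictly_convex : 0 < v < 1 ->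
  (forall x y, D x -> D y -> x < y -> h (mean x y) < mean (h x) (h y)) ->
  strictly_convex D h.
Proof.
move=> v01 hlt.
have chord p s x : D p -> D s -> p < x < s ->
    (s - p) * h x < (s - x) * h p + (x - p) * h s.
  move=> Dp Ds /andP[px xs].
  have ps : p < s := lt_trans px xs.
  have Dps y : p <= y <= s -> D y by move=> ?; exact: (itvD Dp Ds).
  (* This is [h] minus its chord over [[p, s]], multiplied by [s - p] to avoid division. *)
  pose k y := (s - p) * h y - (s - y) * h p - (y - p) * h s.
  have ck : {within `[p, s], continuous k}.
    apply: continuous_in_subspaceT => y; rewrite inE/= in_itv/= => yps.
    apply: cvgB; [apply: cvgB|]; apply: cvgM.
    - exact: cvg_cst.
    - exact: cont_h (Dps _ yps).
    - by apply: cvgB; [exact: cvg_cst|exact: cvg_id].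
    - exact: cvg_cst.
    - by apply: cvgB; [exact: cvg_id|exact: cvg_cst].
    - exact: cvg_cst.
  rewrite ltNge; apply/negP => hx.
  have kx : 0 <= k x by rewrite /k; lra.
  have [c] := EVT_max (ltW ps) ck; rewrite in_itv/= => cps kc.
  (* Since [k] vanishes at [p] and [s] while [0 <= k x], a maximum attained at an endpoint is also
     attained at [x]. *)
  have [m mps km] : exists2 m, p < m < s & forall y, p <= y <= s -> k y <= k m.
    have [cp|cp] := eqVneq c p.
      exists x => [|y yps]; first by rewrite px xs.
      rewrite (le_trans _ kx)// (le_trans (kc _ _))//.
      by rewrite cp /k; lra.
    have [cs|cs] := eqVneq c s.
      exists x => [|y yps]; first by rewrite px xs.
      rewrite (le_trans _ kx)// (le_trans (kc _ _))//.
      by rewrite cs /k; lra.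
    exists c => [|y yps]; last exact: kc.
    by move: cps; rewrite !lt_neqAle cs eq_sym cp /= .
  (* The points [y] and [z] below have [v]-weighted mean [m], and this bound on [d] keeps them in
     [[p, s]]. *)
  pose d := Num.min (m - p) (s - m).
  have d0 : 0 < d by rewrite lt_min !subr_gt0.
  have [dp ds] : d <= m - p /\ d <= s - m by rewrite !ge_min !lexx orbT.
  pose y := m - v * d; pose z := m + (1 - v) * d.
  have [py ym mz zs] : [/\ p <= y, y < m, m < z & z <= s] by rewrite /y /z; split; nra.
  have ky : k y <= k m by apply: km; lra.
  have kz : k z <= k m by apply: km; lra.
  have := hlt y z (Dps _ _) (Dps _ _) (lt_trans ym mz).
  have -> : mean y z = m by rewrite /mean /y /z; ring.
  (* The chord is affine, so it drops out of the defect of [k]. *)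
  have yE : (1 - v) * k y + v * k z - k m =
    (s - p) * (mean (h y) (h z) - h m) by rewrite /mean /k /y /z; ring.
  have sp : 0 < s - p by rewrite subr_gt0.
  move=> /(_ ltac:(lra) ltac:(lra)); rewrite -subr_gt0 -(pmulr_rgt0 _ sp) -yE.
  by nra.
move=> t /andP[t0 t1] x y /set_mem Dx /set_mem Dy xy.
rewrite !convRE; move: (t%:num) t0 t1 => T t0 t1; move: x y Dx Dy xy.
suff key (x y : R) : D x -> D y -> x != y ->
    h (T * x + (1 - T) * y) < T * h x + (1 - T) * h y by exact: key.
move=> Dx Dy xy; have u0 : 0 < 1 - T by rewrite subr_gt0.
have [ltxy|ltyx|eqxy] := ltgtP x y; last by rewrite eqxy eqxx in xy.
  have yx : 0 < y - x by rewrite subr_gt0.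
  have [Tyx uyx] := (mulr_gt0 t0 yx, mulr_gt0 u0 yx).
  rewrite -(ltr_pM2l yx); apply: lt_le_trans (chord x y _ Dx Dy _) _; first by lra.
  by rewrite le_eqVlt; apply/orP/or_introl/eqP; ring.
have yx : 0 < x - y by rewrite subr_gt0.
have [Tyx uyx] := (mulr_gt0 t0 yx, mulr_gt0 u0 yx).
rewrite -(ltr_pM2l yx); apply: lt_le_trans (chord y x _ Dy Dx _) _; first by lra.
by rewrite le_eqVlt; apply/orP/or_introl/eqP; ring.
Qed.

End MeanConvex.

Lemma mean_neq_convex_or_concave {R : realType} (D : set R) (h : R -> R) (v : R) :
  is_interval D -> (forall x, D x -> {for x, continuous h}) -> 0 < v < 1 ->
  (forall x y, D x -> D y -> x < y ->
    h ((1 - v) * x + v * y) != (1 - v) * h x + v * h y) ->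
  strictly_convex D h \/ strictly_concave D h.
Proof.
move=> itvD cont_h v01 /(mean_defect_sign itvD cont_h v01)[hlt|hgt]; [left|right].
  exact: mean_lt_strictly_convex cont_h v01 hlt.
apply: (mean_lt_strictly_convex itvD _ v01) => [x Dx|x y Dx Dy xy].
  by apply: cvgN; exact: cont_h.
by rewrite /= !mulrN -opprD ltrN2; exact: hgt.
Qed.

(** * Strictly monotone extended-real generators and their weighted means *)

Section QuasiLinear.
Context {R : realType}.
Implicit Types (f g : R -> \bar R) (a b c d w x y z : R).

Definition wmean w f a b : \bar R := ((1 - w)%:E * f a + w%:E * f b)%E.

Section Monotone.
Variables (f : R -> \bar R).
Hypothesis f_mono : strictly_monotone `[0, 1] f.

Lemma strictly_monotone01 :
  (forall x y, 0 <= x -> x < y -> y <= 1 -> (f x < f y)%E) \/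
  (forall x y, 0 <= x -> x < y -> y <= 1 -> (f y < f x)%E).
Proof.
case: f_mono => fm; [left|right] => x y x0 xy y1; apply: fm => //;
  by rewrite inE/= in_itv/=; lra.
Qed.

Lemma strictly_monotone01_inj x y :
  0 <= x <= 1 -> 0 <= y <= 1 -> f x = f y -> x = y.
Proof.
move=> /andP[x0 x1] /andP[y0 y1] fxy.
case: strictly_monotone01 => fm; case: (ltgtP x y) => // xy.
- by have := fm _ _ x0 xy y1; rewrite fxy ltxx.
- by have := fm _ _ y0 xy x1; rewrite fxy ltxx.
- by have := fm _ _ x0 xy y1; rewrite fxy ltxx.
- by have := fm _ _ y0 xy x1; rewrite fxy ltxx.
Qed.

(** By strict monotonicity [f x] lies strictly between [f a] and [f b], hence is not infinite. *)
Lemma fin_num_between a x b : 0 <= a -> a < x -> x < b -> b <= 1 ->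
  f x \is a fin_num.
Proof.
move=> a0 ax xb b1; apply/fin_real/andP; split.
  case: strictly_monotone01 => fm.
    exact: le_lt_trans (leNye _) (fm _ _ a0 ax (ltW (lt_le_trans xb b1))).
  exact: le_lt_trans (leNye _) (fm _ _ (ltW (le_lt_trans a0 ax)) xb b1).
case: strictly_monotone01 => fm.
  exact: lt_le_trans (fm _ _ (ltW (le_lt_trans a0 ax)) xb b1) (leey _).
exact: lt_le_trans (fm _ _ a0 ax (ltW (lt_le_trans xb b1))) (leey _).
Qed.

Lemma fin_num_oo x : 0 < x -> x < 1 -> f x \is a fin_num.
Proof. by move=> x0 x1; exact: (@fin_num_between 0 x 1). Qed.

Lemma fin_num_cc a x b : 0 <= a -> a <= x -> x <= b -> b <= 1 ->
  f a \is a fin_num -> f b \is a fin_num -> f x \is a fin_num.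
Proof.
move=> a0; rewrite le_eqVlt => /predU1P[->//|ax].
rewrite le_eqVlt => /predU1P[->//|xb] b1 _ _; exact: fin_num_between a0 ax xb b1.
Qed.

Lemma fhat_monotone :
  (forall x y, 0 <= x -> x < y -> y <= 1 -> f x \is a fin_num ->
    f y \is a fin_num -> fhat f x < fhat f y) \/
  (forall x y, 0 <= x -> x < y -> y <= 1 -> f x \is a fin_num ->
    f y \is a fin_num -> fhat f y < fhat f x).
Proof.
case: strictly_monotone01 => fm; [left|right] => x y x0 xy y1 fx fy;
  by rewrite /fhat/= fine_lt//; exact: fm.
Qed.

Lemma fhat_inj x y : 0 < x < 1 -> 0 < y < 1 -> fhat f x = fhat f y -> x = y.
Proof.
move=> /andP[x0 x1] /andP[y0 y1] e.
apply: strictly_monotone01_inj; rewrite ?(ltW x0) ?(ltW x1) ?(ltW y0) ?(ltW y1)//.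
by rewrite -(fineK (fin_num_oo x0 x1)) -(fineK (fin_num_oo y0 y1)); congr EFin.
Qed.

Lemma wmean_fin w a b : f a \is a fin_num -> f b \is a fin_num ->
  wmean w f a b = ((1 - w) * fhat f a + w * fhat f b)%:E.
Proof. by move=> fa fb; rewrite EFinD !EFinM /fhat /= !fineK. Qed.

Variable w : R.
Hypothesis w01 : 0 < w < 1.

Let w_gt0 : (0 < w%:E)%E. Proof. by rewrite lte_fin; case/andP: w01. Qed.
Let w'_gt0 : (0 < (1 - w)%:E)%E.
Proof. by rewrite lte_fin subr_gt0; case/andP: w01. Qed.

(** Finiteness of [f a] allows cancelling the common summand; an infinite one could absorb the
    other. *)
Lemma wmean_injr a b d : 0 <= b <= 1 -> 0 <= d <= 1 -> f a \is a fin_num ->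
  wmean w f a b = wmean w f a d -> b = d.
Proof.
move=> b01 d01 fa e; apply: strictly_monotone01_inj => //.
apply: contra_eq e => /lt_total.
by case/orP => fbd; [rewrite lt_eqF//|rewrite gt_eqF//];
  rewrite /wmean lteD2lE ?lte_pmul2l// fin_numM.
Qed.

Lemma wmean_injl a b c : 0 <= a <= 1 -> 0 <= c <= 1 -> f b \is a fin_num ->
  wmean w f a b = wmean w f c b -> a = c.
Proof.
move=> b01 d01 fa e; apply: strictly_monotone01_inj => //.
apply: contra_eq e => /lt_total.
by case/orP => fbd; [rewrite lt_eqF//|rewrite gt_eqF//];
  rewrite /wmean lteD2rE ?lte_pmul2l// fin_numM.
Qed.

(** When both endpoints move the same way, the strict inequalities add up even with infinite values:
    the smaller summands are not [+oo] and the larger ones are not [-oo]. *)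
Lemma wmean_neq a b c d : 0 <= a -> a < c -> c <= 1 -> 0 <= b -> b < d -> d <= 1 ->
  wmean w f a b != wmean w f c d.
Proof.
move=> a0 ac c1 b0 bd d1; case: strictly_monotone01 => fm.
  by rewrite lt_eqF//; apply: lteD; rewrite lte_pmul2l//; exact: fm.
by rewrite gt_eqF//; apply: lteD; rewrite lte_pmul2l//; exact: fm.
Qed.

Lemma wmean_nested a b c d : 0 <= a -> a < c -> c <= d -> d < b -> b <= 1 ->
  wmean w f a b = wmean w f c d ->
  [/\ f a \is a fin_num, f b \is a fin_num &
    (1 - w) * (fhat f c - fhat f a) = w * (fhat f b - fhat f d)].
Proof.
move=> a0 ac cd db b1 e.
have fc : f c \is a fin_num by apply: (@fin_num_between a c b) => //; lra.
have fd : f d \is a fin_num by apply: (@fin_num_between a d b) => //; lra.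
(* The mean over the inner points is finite, hence so is the outer one, which forces both of its
   summands to be finite. *)
have [fa fb] : f a \is a fin_num /\ f b \is a fin_num.
  have : wmean w f a b \is a fin_num by rewrite e wmean_fin.
  rewrite /wmean fin_numD => /andP[].
  by case: (f a) (f b) => [?| |] [?| |]; rewrite ?gt0_muley// ?gt0_muleNy.
split => //; move: e; rewrite !wmean_fin// => -[e]; lra.
Qed.

Hypothesis f_cont : {within `[0, 1], continuous f}.

Lemma fhat_within_continuous a b : 0 <= a -> b <= 1 ->
  (forall x, a <= x -> x <= b -> f x \is a fin_num) ->
  {within `[a, b], continuous (fhat f)}.
Proof.
move=> a0 b1 ffin; apply/subspace_continuousP => x; rewrite /= in_itv/= => /andP[ax xb].
apply: fine_cvg; rewrite fineK; last exact: ffin.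
move/subspace_continuousP : f_cont => /(_ x) fx.
apply: cvg_trans (fx _); last by rewrite /= in_itv/=; lra.
apply: cvg_app; apply: within_subset.
by move=> y; rewrite /= !in_itv/= => /andP[ay yb]; rewrite (le_trans a0 ay) (le_trans yb b1).
Qed.

Lemma fhat_cvg_at_right a : 0 <= a -> a < 1 -> f a \is a fin_num ->
  fhat f x @[x --> a^'+] --> fhat f a.
Proof.
(* Stopping at [(a + 1) / 2] stays away from [1], where [f] may be infinite. *)
move=> a0 a1 fa; have ab : a < (a + 1) / 2 by lra.
have : {within `[a, (a + 1) / 2], continuous (fhat f)}.
  apply: fhat_within_continuous => // [|x ax xb]; first by lra.
  apply: (@fin_num_cc a x ((a + 1) / 2)) => //; first by lra.
  apply: fin_num_oo; lra.
by move/(continuous_within_itvP _ ab) => [].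
Qed.

Lemma fhat_cvg_at_left b : 0 < b -> b <= 1 -> f b \is a fin_num ->
  fhat f x @[x --> b^'-] --> fhat f b.
Proof.
move=> b0 b1 fb; have ab : b / 2 < b by lra.
have : {within `[b / 2, b], continuous (fhat f)}.
  apply: fhat_within_continuous => // [|x ax xb]; first by lra.
  apply: (@fin_num_cc (b / 2) x b) => //; first by lra.
  apply: fin_num_oo; lra.
by move/(continuous_within_itvP _ ab) => [].
Qed.

Lemma fhat_continuous x : 0 < x -> x < 1 -> {for x, continuous (fhat f)}.
Proof.
move=> x0 x1; have ab : x / 2 < (x + 1) / 2 by lra.
have : {within `[x / 2, (x + 1) / 2], continuous (fhat f)}.
  apply: fhat_within_continuous => // [||y ay yb]; [by lra|by lra|].
  apply: fin_num_oo; lra.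
by move/(continuous_within_itvP _ ab) => [+ _ _]; apply; rewrite in_itv/=; lra.
Qed.

Lemma wmean_range a b : 0 <= a -> a <= b -> b <= 1 ->
  exists2 c, a <= c <= b & f c = wmean w f a b.
Proof.
move=> a0 ab b1.
have [/andP[fa fb]|] := boolP ((f a \is a fin_num) && (f b \is a fin_num)).
  have cF : {within `[a, b], continuous (fhat f)}.
    by apply: fhat_within_continuous => // x ax xb; exact: fin_num_cc fa fb.
  have [|c] := IVT (v := (1 - w) * fhat f a + w * fhat f b) ab cF.
    have [w0 w1] := andP w01.
    by rewrite ge_min le_max; have [Fab|Fab] := leP (fhat f a) (fhat f b); nra.
  rewrite in_itv/= => /[dup] acb /andP[ac cb] fcE; exists c => //.
  by rewrite wmean_fin// -fcE /fhat/= fineK//; exact: fin_num_cc fa fb.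
(* An infinite endpoint value makes the mean one of the two endpoint values. For opposite infinities
   this is the convention that their sum is [-oo]. *)
move=> nfin; have : wmean w f a b = f a \/ wmean w f a b = f b; last first.
  by case=> ->; [exists a|exists b]; rewrite ?lexx ?ab.
move: nfin; rewrite /wmean.
by case: (f a) (f b) => [?| |] [?| |]//=; rewrite ?gt0_muley// ?gt0_muleNy//; auto.
Qed.

End Monotone.
End QuasiLinear.

(** * Admissibility as joint injectivity *)

Section AdmissiblePairs.
Context {R : realType}.
Implicit Types (u x : Int01 R) (A B : Int01 R -> R).

Lemma Int01P u : [/\ 0 <= lo u, lo u <= hi u & hi u <= 1].
Proof. by case: u => -[a b] /= abP; exact/and3P. Qed.

Lemma Int01_exists (a b : R) : 0 <= a -> a <= b -> b <= 1 ->
  exists2 u, lo u = a & hi u = b.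
Proof.
move=> a0 ab b1; have abP : [&& 0 <= (a, b).1, (a, b).1 <= (a, b).2 & (a, b).2 <= 1].
  by rewrite a0 ab b1.
by exists (exist _ (a, b) abP).
Qed.

Lemma Int01_eq u x : lo u = lo x -> hi u = hi x -> u = x.
Proof.
move=> ulo uhi; apply: val_inj; move: ulo uhi; rewrite /lo /hi.
by case: (val u) (val x) => [? ?] [? ?] /= -> ->.
Qed.

(** For aggregation functions the lexicographic relation is always a total preorder refining the
    interval order; antisymmetry is the only issue. *)
Lemma admissible_pairP A B : aggregation_function A -> aggregation_function B ->
  admissible_pair A B <-> (forall u x, A u = A x -> B u = B x -> u = x).
Proof.
move=> afA afB; split=> [[_ _ [_ anti _ _ _]] u x Aux Bux|inj].
  by apply: anti; rewrite /Defs.le_pair /= Aux Bux eqxx !lexx !orbT.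
have [_ _ _ mA] := afA; have [_ _ _ mB] := afB.
split => //; split.
- by move=> u; rewrite /Defs.le_pair /= eqxx lexx orbT.
- move=> u x; rewrite /Defs.le_pair /=.
  case: (ltgtP (A u) (A x)) => //= Aux /andP[Bux Bxu].
  by apply: inj => //; apply/le_anti; rewrite Bux.
- move=> y u x; rewrite /Defs.le_pair /=.
  case/orP=> [uy|/andP[/eqP-> uy]]; case/orP=> [yx|/andP[/eqP<- yx]].
  + by rewrite (lt_trans uy yx).
  + by rewrite uy.
  + by rewrite yx.
  + by rewrite eqxx (le_trans uy yx) orbT.
- move=> u x; rewrite /Defs.le_pair /=.
  by case: (ltgtP (A u) (A x)) => //= _; exact: le_total.
- move=> u x ux; rewrite /Defs.le_pair /=.
  by have := mA _ _ ux; rewrite le_eqVlt => /orP[->|->//]; rewrite mB// orbT.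
Qed.

End AdmissiblePairs.

(** * Quasi-linear means as aggregation functions *)

Section QuasiLinearMean.
Context {R : realType}.
Variables (f : R -> \bar R) (w : R).
Hypotheses (f_mono : strictly_monotone `[0, 1] f)
  (f_cont : {within `[0, 1], continuous f}) (w01 : 0 < w < 1).

Let K := quasi_linear_mean w f.

(** The weighted mean is a value of [f] on [[0, 1]], so [pinv] is a genuine inverse there. Later
    arguments use this characterization instead of [pinv]. *)
Lemma quasi_linear_meanP u : 0 <= K u <= 1 /\ f (K u) = wmean w f (lo u) (hi u).
Proof.
have [u0 ulh u1] := Int01P u.
have [c uc fc] := wmean_range f_mono w01 f_cont u0 ulh u1.
have c01 : 0 <= c <= 1 by lra.
suff -> : K u = c by [].
rewrite /K /quasi_linear_mean -/(wmean w f (lo u) (hi u)) -fc pinvKV//.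
  move=> x y; rewrite !inE/= !in_itv/= => x01 y01.
  exact (strictly_monotone01_inj f_mono x01 y01).
by rewrite inE/= in_itv.
Qed.

Lemma quasi_linear_mean_eq u x :
  K u = K x <-> wmean w f (lo u) (hi u) = wmean w f (lo x) (hi x).
Proof.
have [Ku fu] := quasi_linear_meanP u; have [Kx fx] := quasi_linear_meanP x.
rewrite -fu -fx; split=> [->//|]; exact (strictly_monotone01_inj f_mono Ku Kx).
Qed.

Lemma wmean_diag a : wmean w f a a = f a.
Proof.
have [w0 w1] := andP w01.
rewrite /wmean; case: (f a) => [r| |]; last 2 first.
- by rewrite !gt0_muley ?lte_fin ?subr_gt0.
- by rewrite !gt0_muleNy ?lte_fin ?subr_gt0.
by rewrite -!EFinM -EFinD -mulrDl subrK mul1r.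
Qed.

Lemma quasi_linear_mean_diag u : lo u = hi u -> K u = lo u.
Proof.
move=> e; have [Ku fu] := quasi_linear_meanP u; have [u0 _ u1] := Int01P u.
apply: (strictly_monotone01_inj f_mono) => //; first by rewrite u0 e u1.
by rewrite fu -e wmean_diag.
Qed.

Lemma quasi_linear_mean_aggregation : aggregation_function K.
Proof.
split=> [u|||u x /andP[lux hux]].
- by case: (quasi_linear_meanP u).
- by rewrite quasi_linear_mean_diag.
- by rewrite quasi_linear_mean_diag.
have [/andP[Ku0 Ku1] fu] := quasi_linear_meanP u.
have [/andP[Kx0 Kx1] fx] := quasi_linear_meanP x.
have [u0 ulh u1] := Int01P u; have [x0 xlh x1] := Int01P x.
have [w0 w1] := andP w01.
have w'0 : 0 < 1 - w by rewrite subr_gt0.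
have lo1 : lo x <= 1 := le_trans xlh x1.
have hi0 : 0 <= hi u := le_trans u0 ulh.
(* The weighted mean varies in the direction of [f], so [K x < K u] would contradict strict
   monotonicity. *)
rewrite leNgt; apply/negP => Kxu.
case: (strictly_monotone01 f_mono) => fm.
  have := fm _ _ Kx0 Kxu Ku1; rewrite fu fx ltNge => /negP; apply.
  apply: leeD; rewrite lee_pmul2l ?lte_fin//.
    by move: lux; rewrite le_eqVlt => /predU1P[->//|ux]; exact/ltW/fm.
  by move: hux; rewrite le_eqVlt => /predU1P[->//|ux]; exact/ltW/fm.
have := fm _ _ Kx0 Kxu Ku1; rewrite fu fx ltNge => /negP; apply.
apply: leeD; rewrite lee_pmul2l ?lte_fin//.
  by move: lux; rewrite le_eqVlt => /predU1P[->//|ux]; exact/ltW/fm.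
by move: hux; rewrite le_eqVlt => /predU1P[->//|ux]; exact/ltW/fm.
Qed.

End QuasiLinearMean.

(** * The composite of one generator with the inverse of the other *)

Section Composite.
Context {R : realType}.
Variables (f g : R -> \bar R).
Hypotheses (f_mono : strictly_monotone `[0, 1] f) (g_mono : strictly_monotone `[0, 1] g)
  (f_cont : {within `[0, 1], continuous f}) (g_cont : {within `[0, 1], continuous g}).

Lemma pinv_fhatK (x : R) : 0 < x < 1 -> pinv (`]0, 1[ : set R) (fhat f) (fhat f x) = x.
Proof.
move=> x01; rewrite pinvKV// ?inE//= ?in_itv// => y z.
by rewrite !inE/= !in_itv/=; exact: fhat_inj.
Qed.

Lemma hhatE (x : R) : 0 < x < 1 -> hhat f g (fhat f x) = fhat g x.
Proof. by move=> x01; rewrite /hhat/= pinv_fhatK. Qed.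

Lemma ran_hatP p : ran_hat f p <-> exists2 x, 0 < x < 1 & fhat f x = p.
Proof.
by split=> -[x x01 <-]; exists x => //; move: x01; rewrite /= in_itv.
Qed.

Lemma ran_hat_interval : is_interval (ran_hat f).
Proof.
apply/connected_intervalP/connected_continuous_connected.
  exact/connected_intervalP/interval_is_interval.
apply: continuous_in_subspaceT => x; rewrite inE/= in_itv/= => /andP[x0 x1].
exact: fhat_continuous.
Qed.

Lemma hhat_continuous p : ran_hat f p -> {for p, continuous (hhat f g)}.
Proof.
move=> /ran_hatP[x /[dup] x01 /andP[x0 x1] <-].
have xN : \near x, 0 < x < 1.
  near=> y; apply/andP; split; near: y; [exact: lt_nbhsr|exact: lt_nbhsl].
(* The local inverse of a continuous injective real function is continuous. *)
have /nbhs_singleton pc : \forall p \near fhat f x,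
    {for p, continuous (pinv (`]0, 1[ : set R) (fhat f))}.
  apply: near_can_continuous; first by near=> y; apply: pinv_fhatK => //; near: y.
  near=> y; have /andP[y0 y1] : 0 < y < 1 by near: y.
  exact: fhat_continuous.
apply: continuous_comp; first exact: pc.
by rewrite /continuous_at pinv_fhatK//; exact: fhat_continuous.
Unshelve. all: by end_near. Qed.

End Composite.

(** * Collisions between nested intervals *)

Section Collisions.
Context {R : realType}.
Variables (f g : R -> \bar R).
Hypotheses (f_mono : strictly_monotone `[0, 1] f) (g_mono : strictly_monotone `[0, 1] g)
  (f_cont : {within `[0, 1], continuous f}) (g_cont : {within `[0, 1], continuous g}).

Let F := fhat f.
Let G := fhat g.
Let h := hhat f g.
Let D := ran_hat f.

(** The two equations say that [[a, b]] and [[c, d]] have equal means for both generators. The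
    finiteness assumptions cost nothing, as [wmean_nested] provides them. *)
Definition no_nested_collision (w1 w2 : R) : Prop := forall a c d b : R,
  0 <= a -> a < c -> c <= d -> d < b -> b <= 1 ->
  f a \is a fin_num -> f b \is a fin_num ->
  g a \is a fin_num -> g b \is a fin_num ->
  (1 - w1) * (F c - F a) = w1 * (F b - F d) ->
  (1 - w2) * (G c - G a) = w2 * (G b - G d) -> False.

Lemma admissible_no_collision (w1 w2 : R) : 0 < w1 < 1 -> 0 < w2 < 1 ->
  (mine `|f 0%R| `|g 0%R| < +oo)%E -> (mine `|f 1%R| `|g 1%R| < +oo)%E ->
  no_nested_collision w1 w2 ->
  admissible_pair (quasi_linear_mean w1 f) (quasi_linear_mean w2 g).
Proof.
move=> w1_01 w2_01 fg0 fg1 nested.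
apply/admissible_pairP; [exact: quasi_linear_mean_aggregation..|].
move=> u x /(quasi_linear_mean_eq f_mono f_cont w1_01) fux.
move=> /(quasi_linear_mean_eq g_mono g_cont w2_01) gux.
move: (Int01P u) (Int01P x) fux gux => {}.
suff key (a b c d : R) : 0 <= a -> a <= b -> b <= 1 -> 0 <= c -> c <= d -> d <= 1 ->
    wmean w1 f a b = wmean w1 f c d -> wmean w2 g a b = wmean w2 g c d ->
    a = c /\ b = d.
  move=> [u0 u01 u1] [x0 x01 x1] fux gux.
  by have [] := key _ _ _ _ u0 u01 u1 x0 x01 x1 fux gux; exact: Int01_eq.
(* At a common left endpoint, some generator is finite and can be cancelled; [fin1] does the same on
   the right. *)
have fin0 p : 0 <= p -> p < 1 -> f p \is a fin_num \/ g p \is a fin_num.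
  rewrite le_eqVlt => /predU1P[<- _|p0 p1]; last by left; exact: fin_num_oo.
  by move: fg0; rewrite gt_min => /orP[fin|fin]; [left|right]; rewrite fin_num_abs.
have fin1 p : 0 < p -> p <= 1 -> f p \is a fin_num \/ g p \is a fin_num.
  move=> p0; rewrite le_eqVlt => /predU1P[->|p1]; last by left; exact: fin_num_oo.
  by move: fg1; rewrite gt_min => /orP[fin|fin]; [left|right]; rewrite fin_num_abs.
wlog ac : a b c d / a <= c.
  move=> wl a0 ab b1 c0 cd d1 fe ge; have [ac|/ltW ca] := leP a c; first exact: wl.
  by have [] := wl _ _ _ _ ca c0 cd d1 a0 ab b1 (esym fe) (esym ge).
move=> a0 ab b1 c0 cd d1 fe ge.
move: ac; rewrite le_eqVlt => /predU1P[ac|ac].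
  (* The left endpoints agree. If [a = 1], both intervals are degenerate; otherwise a generator
     finite at [a] separates the right endpoints. *)
  subst c; split=> //.
  have [a1|a1] := ltP a 1; last by apply/le_anti; lra.
  have [fa|ga] := fin0 a a0 a1.
    by apply: (wmean_injr f_mono w1_01 _ _ fa fe); lra.
  by apply: (wmean_injr g_mono w2_01 _ _ ga ge); lra.
exfalso; have [db|bd|bd] := ltgtP d b.
- have [fa fb fcd] := wmean_nested f_mono w1_01 a0 ac cd db b1 fe.
  have [ga gb gcd] := wmean_nested g_mono w2_01 a0 ac cd db b1 ge.
  exact: nested fcd gcd.
- have b0 : 0 <= b by lra.
  have c1 : c <= 1 by lra.
  by have := wmean_neq f_mono w1_01 a0 ac c1 b0 bd d1; rewrite fe eqxx.
- subst d; have b0 : 0 < b by lra.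
  have : a = c; last by lra.
  have [fb|gb] := fin1 b b0 b1.
    by apply: (wmean_injl f_mono w1_01 _ _ fb fe); lra.
  by apply: (wmean_injl g_mono w2_01 _ _ gb ge); lra.
Qed.

(** With equality, [[x, z]] and the degenerate interval at its [f]-mean [y] would have equal means
    for both generators. *)
Lemma admissible_mean_neq (w : R) : 0 < w < 1 ->
  admissible_pair (quasi_linear_mean w f) (quasi_linear_mean w g) ->
  forall x z, 0 < x -> x < z -> z < 1 ->
  h ((1 - w) * F x + w * F z) != (1 - w) * G x + w * G z.
Proof.
move=> w01 adm x z x0 xz z1; apply/eqP => hE.
have injK : forall u y, quasi_linear_mean w f u = quasi_linear_mean w f y ->
    quasi_linear_mean w g u = quasi_linear_mean w g y -> u = y.
  by apply/admissible_pairP => //; exact: quasi_linear_mean_aggregation.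
have [fx fz] : f x \is a fin_num /\ f z \is a fin_num.
  by split; apply: fin_num_oo => //; lra.
have [gx gz] : g x \is a fin_num /\ g z \is a fin_num.
  by split; apply: fin_num_oo => //; lra.
have [y /andP[xy yz] fy] := wmean_range f_mono w01 f_cont (ltW x0) (ltW xz) (ltW z1).
have [y0 y1] : 0 < y /\ y < 1 by lra.
have Fy : F y = (1 - w) * F x + w * F z by rewrite /F {1}/fhat /= fy wmean_fin.
have gy := fin_num_oo g_mono y0 y1.
have [u ulo uhi] := Int01_exists (ltW x0) (ltW xz) (ltW z1).
have [v vlo vhi] := Int01_exists (ltW y0) (lexx y) (ltW y1).
have : u = v.
  apply: injK; apply/quasi_linear_mean_eq => //; rewrite ulo uhi vlo vhi wmean_diag//.
  rewrite wmean_fin// -/G -hE -Fy /h /F hhatE ?y0// /fhat /=.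
  by rewrite fineK.
by move=> uv; move: vlo vhi; rewrite -uv ulo uhi; lra.
Qed.

Lemma admissible_convex_or_concave (w : R) : 0 < w < 1 ->
  admissible_pair (quasi_linear_mean w f) (quasi_linear_mean w g) ->
  strictly_convex D h \/ strictly_concave D h.
Proof.
move=> w01 /(admissible_mean_neq w01) hne.
have itvD := ran_hat_interval f_mono f_cont.
have ch := hhat_continuous f_mono g_mono f_cont g_cont.
case: (fhat_monotone f_mono) => fm.
  apply: (mean_neq_convex_or_concave itvD ch w01) => p q.
  move=> /ran_hatP[x x01 <-] /ran_hatP[y y01 <-] Fxy.
  rewrite /h !hhatE//; apply: hne; [lra| |lra].
  rewrite ltNge le_eqVlt; apply/negP => /predU1P[yx|yx].
    by rewrite yx ltxx in Fxy.
  have [fx fy] : f x \is a fin_num /\ f y \is a fin_num.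
    by split; apply: fin_num_oo => //; lra.
  have : F x < F x by apply: (lt_trans Fxy); apply: fm => //; lra.
  by rewrite ltxx.
(* A decreasing [F] reverses the order of the two points, which exchanges the weights [w] and
   [1 - w]. *)
have w'01 : 0 < 1 - w < 1 by lra.
apply: (mean_neq_convex_or_concave itvD ch w'01) => p q.
move=> /ran_hatP[x x01 <-] /ran_hatP[y y01 <-] Fxy.
rewrite /h !hhatE// subKr addrC [X in _ != X]addrC; apply: hne; [lra| |lra].
rewrite ltNge le_eqVlt; apply/negP => /predU1P[yx|yx].
  by rewrite yx ltxx in Fxy.
have [fx fy] : f x \is a fin_num /\ f y \is a fin_num.
  by split; apply: fin_num_oo => //; lra.
have : F x < F x by apply: (lt_trans Fxy); apply: fm => //; lra.
by rewrite ltxx.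
Qed.

Section FixedSign.
Local Open Scope convex_scope.
Variable H : R -> R.
Hypothesis HG : H = G \/ H = \- G.

(** The factor [F z - F x] compensates the sign change of the area when [F] is decreasing, so what
    remains is a square times the convexity gap. *)
Let conv_fhat x y z : 0 < x -> x < y -> y < z -> z < 1 ->
  exists t : {i01 R}, [/\ 0 < t%:num < 1, F y = t%:num * F x + (1 - t%:num) * F z &
    (F z - F x) * area F H x y z =
    (F z - F x) ^+ 2 * (t%:num * H x + (1 - t%:num) * H z - H y)].
Proof.
move=> x0 xy yz z1.
have [fx fy fz] : [/\ f x \is a fin_num, f y \is a fin_num & f z \is a fin_num].
  by split; apply: fin_num_oo => //; lra.
have : (F x < F y < F z) || (F z < F y < F x).
  case: (fhat_monotone f_mono) => fm; apply/orP; [left|right];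
    by apply/andP; split; apply: fm => //; lra.
move=> /between_conv[t [t01 Fy tF]]; exists t; split => //.
have -> : area F H x y z =
  (F z - F x) * (H z - H y) - t%:num * (F z - F x) * (H z - H x).
  by rewrite tF /area; ring.
by ring.
Qed.

Lemma convex_area_ge0 (k : R -> R) : (forall x, 0 < x < 1 -> k (F x) = H x) ->
  convex_function D k -> forall x y z, 0 < x -> x < y -> y < z -> z < 1 ->
  0 <= (F z - F x) * area F H x y z.
Proof.
move=> kH convk x y z x0 xy yz z1.
have [t [t01 Fy ->]] := conv_fhat x0 xy yz z1.
rewrite mulr_ge0 ?sqr_ge0// subr_ge0.
have [Dx Dz] : D (F x) /\ D (F z).
  by split; apply/ran_hatP; eexists => //; lra.
have := convk t (F x) (F z) (mem_set Dx) (mem_set Dz).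
rewrite [X in k X](_ : _ = F y); last by rewrite Fy; exact: (@convRE R).
by rewrite convRE !kH //; lra.
Qed.

Lemma strictly_convex_area_gt0 (k : R -> R) : (forall x, 0 < x < 1 -> k (F x) = H x) ->
  strictly_convex D k -> forall x y z, 0 < x -> x < y -> y < z -> z < 1 ->
  0 < (F z - F x) * area F H x y z.
Proof.
move=> kH convk x y z x0 xy yz z1.
have [t [t01 Fy ->]] := conv_fhat x0 xy yz z1.
have [Dx Dz] : D (F x) /\ D (F z).
  by split; apply/ran_hatP; eexists => //; lra.
have Fxz : F x != F z.
  apply/eqP => /(fhat_inj f_mono) xz.
  by have : x = z by [apply: xz; lra]; lra.
apply: mulr_gt0; first by rewrite exprn_even_gt0//= subr_eq0 eq_sym.
rewrite subr_gt0.
have := convk t t01 (F x) (F z) (mem_set Dx) (mem_set Dz) Fxz.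
have -> : (F x : R^o) <| t |> (F z : R^o) = F y by rewrite convRE Fy.
by rewrite convRE !kH //; lra.
Qed.

Section Nested.
Variables (w a c d b : R).
Hypotheses (a0 : 0 <= a) (ac : a < c) (cd : c <= d) (db : d < b) (b1 : b <= 1).
Hypotheses (fa : f a \is a fin_num) (fb : f b \is a fin_num)
  (ga : g a \is a fin_num) (gb : g b \is a fin_num).
Hypothesis Fcd : (1 - w) * (F c - F a) = w * (F b - F d).

Let ab : a < b. Proof. exact: lt_trans ac (le_lt_trans cd db). Qed.
Let a1 : a < 1. Proof. exact: lt_le_trans b1. Qed.
Let b0 : 0 < b. Proof. exact: le_lt_trans ab. Qed.

Let Ha : H x @[x --> a^'+] --> H a.
Proof.
have Ga := fhat_cvg_at_right g_mono g_cont a0 a1 ga.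
by case: HG => ->; [|apply: cvgN].
Qed.

Let Hb : H x @[x --> b^'-] --> H b.
Proof.
have Gb := fhat_cvg_at_left g_mono g_cont b0 b1 gb.
by case: HG => ->; [|apply: cvgN].
Qed.

Let Fa := fhat_cvg_at_right f_mono f_cont a0 a1 fa.
Let Fb := fhat_cvg_at_left f_mono f_cont b0 b1 fb.

Let fin x : a <= x -> x <= b -> f x \is a fin_num.
Proof. by move=> ax xb; exact: fin_num_cc fa fb. Qed.

(** The nested mean lemmas require an increasing first function: [F'] is [F] or [- F], and the sign
    of the area is absorbed into the positive factor [r]. *)
Let F_oriented : exists F' : R -> R, [/\ F' x @[x --> a^'+] --> F' a,
    F' x @[x --> b^'-] --> F' b,
    forall x y, a <= x -> x < y -> y <= b -> F' x < F' y,
    (1 - w) * (F' c - F' a) = w * (F' b - F' d) &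
    forall x y z, 0 < x -> x < y -> y < z -> z < 1 ->
      exists2 r, 0 < r & (F z - F x) * area F H x y z = r * area F' H x y z].
Proof.
have F_mono x y : a <= x -> x < y -> y <= b ->
    [/\ 0 <= x, y <= 1, f x \is a fin_num & f y \is a fin_num].
  move=> ax xy yb; split; [exact: le_trans ax|exact: le_trans b1| |].
    exact: fin (le_trans (ltW xy) yb).
  exact: fin (le_trans ax (ltW xy)) yb.
have oo_fin x z : 0 < x -> x < z -> z < 1 -> f x \is a fin_num /\ f z \is a fin_num.
  by move=> x0 xz z1; split; apply: fin_num_oo => //; lra.
case: (fhat_monotone f_mono) => fm; [exists F|exists (\- F)]; split => //.
- by move=> x y ax xy yb; have [x0 y1 fx fy] := F_mono _ _ ax xy yb; exact: fm.
- move=> x y z x0 xy yz z1; exists (F z - F x) => //.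
  have [fx fz] := oo_fin _ _ x0 (lt_trans xy yz) z1.
  by rewrite subr_gt0; apply: fm => //; lra.
- exact: cvgN.
- exact: cvgN.
- move=> x y ax xy yb; have [x0 y1 fx fy] := F_mono _ _ ax xy yb.
  by rewrite ltrN2; exact: fm.
- by have := Fcd; rewrite /=; lra.
- move=> x y z x0 xy yz z1; exists (F x - F z); last by rewrite /area /=; ring.
  have [fx fz] := oo_fin _ _ x0 (lt_trans xy yz) z1.
  by rewrite subr_gt0; apply: fm => //; lra.
Qed.

Lemma fhat_nested_mean_le : 0 < w < 1 ->
  (forall x y z, 0 < x -> x < y -> y < z -> z < 1 ->
    0 <= (F z - F x) * area F H x y z) ->
  (1 - w) * (H c - H a) <= w * (H b - H d).
Proof.
move=> w01 FH; have [F' [F'a F'b F'_incr F'cd F'_area]] := F_oriented.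
apply: (nested_mean_le F'a Ha F'b Hb) => // x y z x0 xy yz z1.
have [r r0 rE] := F'_area _ _ _ x0 xy yz z1.
by have := FH _ _ _ x0 xy yz z1; rewrite rE pmulr_rge0.
Qed.

Lemma fhat_nested_mean_lt : 0 < w < 1 ->
  (forall x y z, 0 < x -> x < y -> y < z -> z < 1 ->
    0 < (F z - F x) * area F H x y z) ->
  (1 - w) * (H c - H a) < w * (H b - H d).
Proof.
move=> w01 FH; have [F' [F'a F'b F'_incr F'cd F'_area]] := F_oriented.
apply: (nested_mean_lt F'a Ha F'b Hb) => // x y z x0 xy yz z1.
have [r r0 rE] := F'_area _ _ _ x0 xy yz z1.
by have := FH _ _ _ x0 xy yz z1; rewrite rE pmulr_rgt0.
Qed.

End Nested.
End FixedSign.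

End Collisions.

(** * Convexity excludes nested collisions *)

Section NoCollision.
Context {R : realType}.
Variables (f g : R -> \bar R).
Hypotheses (f_mono : strictly_monotone `[0, 1] f) (g_mono : strictly_monotone `[0, 1] g)
  (f_cont : {within `[0, 1], continuous f}) (g_cont : {within `[0, 1], continuous g}).

Lemma strictly_convex_no_collision (H k : R -> R) (w : R) : 0 < w < 1 ->
  H = fhat g \/ H = \- fhat g -> (forall x, 0 < x < 1 -> k (fhat f x) = H x) ->
  strictly_convex (ran_hat f) k -> no_nested_collision f g w w.
Proof.
move=> w01 HG kH convk a c d b a0 ac cd db b1 fa fb ga gb Fe Ge.
have area_gt0 := strictly_convex_area_gt0 f_mono kH convk.
have := fhat_nested_mean_lt f_mono g_mono f_cont g_cont HG a0 ac cd db b1 fa fb ga gb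
  Fe w01 area_gt0.
by case: HG Ge => -> /= Ge; lra.
Qed.

(* Replacing [w1] by [w2] makes the inequality
   [(1 - w1) * (H c - H a) <= w1 * (H b - H d)] given by convexity strict, which
   excludes equality for [w2]. *)
Lemma convex_no_collision (H k : R -> R) (w1 w2 : R) : 0 < w1 < 1 -> 0 < w2 < 1 ->
  H = fhat g \/ H = \- fhat g -> (forall x, 0 < x < 1 -> k (fhat f x) = H x) ->
  convex_function (ran_hat f) k ->
  (w1 < w2 /\ (forall x y, 0 < x -> x < y -> y < 1 -> H x < H y)) \/
  (w2 < w1 /\ (forall x y, 0 < x -> x < y -> y < 1 -> H y < H x)) ->
  no_nested_collision f g w1 w2.
Proof.
move=> w1_01 w2_01 HG kH convk mono a c d b a0 ac cd db b1 fa fb ga gb Fe Ge.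
have area_ge0 := convex_area_ge0 f_mono kH convk.
have := fhat_nested_mean_le f_mono g_mono f_cont g_cont HG a0 ac cd db b1 fa fb ga gb
  Fe w1_01 area_ge0.
have {Ge} : (1 - w2) * (H c - H a) = w2 * (H b - H d).
  by case: HG Ge => -> /= Ge; lra.
have gin x : 0 < x -> x < 1 -> g x \is a fin_num by exact: fin_num_oo.
have [gc gd] : g c \is a fin_num /\ g d \is a fin_num.
  by split; apply: gin; lra.
have [g3 g2] : g (1 / 3) \is a fin_num /\ g (1 / 2) \is a fin_num.
  by split; apply: gin; lra.
(* The assumed direction of [H] concerns the open interval, but [a] and [b] may be [0] and [1].
   Comparing [1 / 3] with [1 / 2] identifies it with the direction of [g] on the closed interval. *)
have Hmono : (H a < H c /\ H d < H b /\ H (1 / 3) < H (1 / 2)) \/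
             (H c < H a /\ H b < H d /\ H (1 / 2) < H (1 / 3)).
  have : (fhat g a < fhat g c /\ fhat g d < fhat g b /\ fhat g (1 / 3) < fhat g (1 / 2)) \/
         (fhat g c < fhat g a /\ fhat g b < fhat g d /\ fhat g (1 / 2) < fhat g (1 / 3)).
    by case: (fhat_monotone g_mono) => gm; [left|right];
      (split; [|split]); apply: gm => //; lra.
  by case: HG => -> //= [[? [? ?]]|[? [? ?]]]; rewrite !ltrN2; [right|left].
have [w10 w11] := andP w1_01; have [w20 w21] := andP w2_01.
case: mono => -[w12 /(_ (1 / 3) (1 / 2) ltac:(lra) ltac:(lra) ltac:(lra)) Hm];
  case: Hmono => -[Hac [Hdb H32]]; try lra; move=> He Hle.
(* Subtracting the equation for [w2] from the inequality for [w1] shows that this sum is at most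
   [0]. *)
- have : (w2 - w1) * (H c - H a) + (w2 - w1) * (H b - H d) > 0.
    by apply: addr_gt0; apply: mulr_gt0; lra.
  lra.
- have : (w1 - w2) * (H a - H c) + (w1 - w2) * (H d - H b) > 0.
    by apply: addr_gt0; apply: mulr_gt0; lra.
  lra.
Qed.

Section FactorThroughFhat.
Variables (H k : R -> R).
Hypothesis kH : forall x, 0 < x < 1 -> k (fhat f x) = H x.

Let ran_hat_fhat (x : R) : 0 < x < 1 -> fhat f x \in ran_hat f.
Proof. by move=> x01; apply/mem_set/ran_hatP; exists x. Qed.

Let in_oo (x : R) : 0 < x < 1 -> x \in `]0, 1[%classic.
Proof. by move=> x01; rewrite inE/= in_itv. Qed.

(** On []0, 1[], [H] is [k] after [fhat f]: equal directions compose to an increasing function,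
    opposite ones to a decreasing one. *)
Lemma factor_increasing :
  strictly_increasing `]0, 1[ (fhat f) /\ strictly_increasing (ran_hat f) k \/
  strictly_decreasing `]0, 1[ (fhat f) /\ strictly_decreasing (ran_hat f) k ->
  forall x y, 0 < x -> x < y -> y < 1 -> H x < H y.
Proof.
move=> fk x y x0 xy y1; have [x01 y01] : 0 < x < 1 /\ 0 < y < 1 by lra.
by rewrite -!kH//; case: fk => -[fm km]; apply: km; rewrite ?ran_hat_fhat//;
  apply: fm; rewrite ?in_oo.
Qed.

Lemma factor_decreasing :
  strictly_increasing `]0, 1[ (fhat f) /\ strictly_decreasing (ran_hat f) k \/
  strictly_decreasing `]0, 1[ (fhat f) /\ strictly_increasing (ran_hat f) k ->
  forall x y, 0 < x -> x < y -> y < 1 -> H y < H x.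
Proof.
move=> fk x y x0 xy y1; have [x01 y01] : 0 < x < 1 /\ 0 < y < 1 by lra.
by rewrite -!kH//; case: fk => -[fm km]; apply: km; rewrite ?ran_hat_fhat//;
  apply: fm; rewrite ?in_oo.
Qed.

End FactorThroughFhat.

End NoCollision.

Theorem theorem4p3 (R : realType) (w1 w2 : R) (f g : R -> \bar R)
  (w1_01 : 0 < w1 < 1) (w2_01 : 0 < w2 < 1)
  (f_mono : strictly_monotone `[0, 1] f)
  (g_mono : strictly_monotone `[0, 1] g)
  (f_cont : {within `[0, 1], continuous f})
  (g_cont : {within `[0, 1], continuous g})
  (fg0 : (mine `|f 0%R| `|g 0%R| < +oo)%E)
  (fg1 : (mine `|f 1%R| `|g 1%R| < +oo)%E) :
  let h := hhat f g in
  let D := ran_hat f in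
  let K1 := quasi_linear_mean w1 f in
  let K2 := quasi_linear_mean w2 g in
  (w1 = w2 ->
    (admissible_pair K1 K2 <-> strictly_convex D h \/ strictly_concave D h))
  /\
  (w1 <> w2 ->
    (strictly_increasing `]0, 1[ (fhat f) /\
      ((w1 < w2 /\
          ((convex_function D h /\ strictly_increasing D h) \/
           (convex_function D (\- h) /\ strictly_increasing D (\- h)))) \/
       (w1 > w2 /\
          ((convex_function D h /\ strictly_decreasing D h) \/
           (convex_function D (\- h) /\ strictly_decreasing D (\- h))))))
    \/
    (strictly_decreasing `]0, 1[ (fhat f) /\
      ((w1 < w2 /\
          ((convex_function D h /\ strictly_decreasing D h) \/
           (convex_function D (\- h) /\ strictly_decreasing D (\- h)))) \/
       (w1 > w2 /\
          ((convex_function D h /\ strictly_increasing D h) \/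
           (convex_function D (\- h) /\ strictly_increasing D (\- h)))))) ->
    admissible_pair K1 K2).
Proof.
move=> h D K1 K2.
have hE (x : R) : 0 < x < 1 -> h (fhat f x) = fhat g x by exact: hhatE.
have hNE (x : R) : 0 < x < 1 -> (\- h) (fhat f x) = (\- fhat g) x.
  by move=> x01; rewrite /= hE.
split=> [w12|_].
  split; first by rewrite /K1 /K2 -w12; exact: admissible_convex_or_concave.
  move=> conv_h; apply: admissible_no_collision => //; rewrite -w12.
  case: conv_h => [conv_h|conv_h].
    by apply: (strictly_convex_no_collision _ _ _ _ w1_01 (or_introl erefl) hE).
  by apply: (strictly_convex_no_collision _ _ _ _ w1_01 (or_intror erefl) hNE).
(* Cases (b) and (c) differ only in the directions of [fhat f] and [k]; the direction of [H] alone
   must match the order of the weights. *)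
have conv_adm (H k : R -> R) : H = fhat g \/ H = \- fhat g ->
    (forall x, 0 < x < 1 -> k (fhat f x) = H x) -> convex_function D k ->
    (w1 < w2 /\ (forall x y, 0 < x -> x < y -> y < 1 -> H x < H y)) \/
    (w2 < w1 /\ (forall x y, 0 < x -> x < y -> y < 1 -> H y < H x)) ->
    admissible_pair K1 K2.
  move=> HG kH convk Hm; apply: admissible_no_collision => //.
  exact: (convex_no_collision f_mono g_mono f_cont g_cont w1_01 w2_01 HG kH convk Hm).
have hadm := conv_adm _ _ (or_introl erefl) hE.
have hNadm := conv_adm _ _ (or_intror erefl) hNE.
case=> -[fm [[w12 [[ch mh]|[ch mh]]]|[w12 [[ch mh]|[ch mh]]]]].
- by apply: hadm => //; left; split => //; apply: (factor_increasing hE); left.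
- by apply: hNadm => //; left; split => //; apply: (factor_increasing hNE); left.
- by apply: hadm => //; right; split => //; apply: (factor_decreasing hE); left.
- by apply: hNadm => //; right; split => //; apply: (factor_decreasing hNE); left.
- by apply: hadm => //; left; split => //; apply: (factor_increasing hE); right.
- by apply: hNadm => //; left; split => //; apply: (factor_increasing hNE); right.
- by apply: hadm => //; right; split => //; apply: (factor_decreasing hE); right.
- by apply: hNadm => //; right; split => //; apply: (factor_decreasing hNE); right.
Qed.
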